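(* Let $f:\mathbb{R}^{2n}\to\mathbb{R}$ be the penalized placement objective $$f(z)=\operatorname{HPWL}(z)+\sum_{i=1}^n\gamma_i\,\ell_b(x_i,y_i)+\sum_{1\le i<j\le n}\gamma_{ij}\,\ell_{xy}(x_i,y_i,x_j,y_j)$$ defined in the context, let $\partial f(z)$ denote its Clarke subdifferential at $z$, and let $S=\{z\in\mathbb{R}^{2n}:0\in\partial f(z)\}$. Then the set $$G_{S^c}:=\{\,\|s\| : s\in\partial f(z),\ z\notin S\,\}$$ has a positive lower bound and a (finite) upper bound; that is, there exist constants $0<\beta\le L_g<\infty$ such that $\beta\le\|s\|\le L_g$ for every $z\notin S$ and every $s\in\partial f(z)$.
   Context: Placement data: $V=\{v_1,\dots,v_n\}$ is a finite set of cells; cell $v_i$ is a rectangle of width $w_i>0$ and height $h_i>0$ with center $(x_i,y_i)\in\mathbb{R}^2$. $E=\{e_1,\dots,e_m\}$ is a finite set of nets, each net being a nonempty subset of $V$. The placement region is the rectangle with lower left corner $(0,0)$ and upper right corner $(W,H)$. Write $z=(x,y)$ with $x=(x_1,\dots,x_n)$, $y=(y_1,\dots,y_n)$, regarded as an element of $\mathbb{R}^{2n}$. $\operatorname{ReLU}(t)=\max(0,t)$ for $t\in\mathbb{R}$. Half-perimeter wirelength: $\operatorname{HPWL}(z)=\sum_{e\in E}\bigl(\max_{v_i,v_j\in e}|x_i-x_j|+\max_{v_i,v_j\in e}|y_i-y_j|\bigr)$. Boundary penalty: $\ell_b(x_i,y_i)=\operatorname{ReLU}(\tfrac{w_i}{2}-x_i)+\operatorname{ReLU}(x_i-w_i^+)+\operatorname{ReLU}(\tfrac{h_i}{2}-y_i)+\operatorname{ReLU}(y_i-h_i^+)$,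 where $w_i^+=W-w_i/2$ and $h_i^+=H-h_i/2$. Overlap penalty: for $r,t>0$ define $\varphi_{r,t}:\mathbb{R}^2\to\mathbb{R}$ by $\varphi_{r,t}(x,y)=0$ if $|x|\ge r$ or $|y|\ge t$; $\varphi_{r,t}(x,y)=1-|x|/r$ if $|y|/t\le|x|/r<1$; $\varphi_{r,t}(x,y)=1-|y|/t$ if $|x|/r<|y|/t<1$. Then $\ell_{xy}(x_i,y_i,x_j,y_j)=\varphi_{w_{ij},h_{ij}}(x_i-x_j,\,y_i-y_j)$ with $w_{ij}=\frac{w_i+w_j}{2}$, $h_{ij}=\frac{h_i+h_j}{2}$. The $\gamma_i>0$ and $\gamma_{ij}>0$ are fixed real penalty parameters. For a locally Lipschitz function $F$ on $\mathbb{R}^{N}$, the Clarke subdifferential $\partial F(z)$ is the closed convex hull of all limits $\lim_{j\to\infty}\nabla F(z_j)$ with $z_j\to z$ and $F$ differentiable at each $z_j$. $\|\cdot\|$ is the Euclidean norm. *)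

(* Defs.v *)
From HB Require Import structures.
From mathcomp Require Import all_boot all_order all_algebra.
From mathcomp Require Import all_classical all_reals all_analysis.

Set Implicit Arguments.
Unset Strict Implicit.
Unset Printing Implicit Defensive.

Import Order.TTheory GRing.Theory Num.Theory.
Import numFieldNormedType.Exports.

Local Open Scope classical_set_scope.
Local Open Scope ring_scope.

(* The library's norm on 'rV[R]_N is the sup norm.  It is equivalent to this
   one, so limits, closed sets and differentiability below are the Euclidean
   ones. *)
Definition l2norm (R : realType) (N : nat) (s : 'rV[R]_N) : R :=
  Num.sqrt (\sum_(i < N) s 0 i ^+ 2).

Definition gradient (R : realType) (N : nat) (F : 'rV[R]_N -> R^o)
    (z : 'rV[R]_N) : 'rV[R]_N :=
  \row_i 'D_(delta_mx 0 i) F z.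

Definition limiting_gradients (R : realType) (N : nat) (F : 'rV[R]_N -> R^o)
    (z : 'rV[R]_N) : set 'rV[R]_N :=
  [set g | exists u : nat -> 'rV[R]_N,
    [/\ u @ \oo --> z, forall j, differentiable F (u j)
      & (gradient F (u j)) @[j --> \oo] --> g]].

Definition closed_convex_hull (R : realType) (N : nat) (A : set 'rV[R]_N) :
    set 'rV[R]_N :=
  smallest [set C : set 'rV[R]_N |
    closed C /\ convex_set (C : set (convex_lmodType 'rV[R]_N))] A.

(* Meaningful for locally Lipschitz F. *)
Definition clarke_subdifferential (R : realType) (N : nat)
    (F : 'rV[R]_N -> R^o) (z : 'rV[R]_N) : set 'rV[R]_N :=
  closed_convex_hull (limiting_gradients F z).

Definition stationary_points (R : realType) (N : nat) (F : 'rV[R]_N -> R^o) :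
    set 'rV[R]_N :=
  [set z | clarke_subdifferential F z 0].

(* A placement z = (x, y) of n cells is the row vector z = row_mx x y. *)
Definition xcoord (R : realType) (n : nat) (z : 'rV[R]_(n + n)) (i : 'I_n) : R :=
  z 0 (lshift n i).

Definition ycoord (R : realType) (n : nat) (z : 'rV[R]_(n + n)) (i : 'I_n) : R :=
  z 0 (rshift n i).

Definition ReLU (R : realType) (t : R) : R := Num.max 0 t.

(* The default value 0 of the maxima is attained at i = j, as nets are
   nonempty. *)
Definition HPWL (R : realType) (n : nat) (E : {set {set 'I_n}})
    (z : 'rV[R]_(n + n)) : R :=
  \sum_(e in E)
    (\big[Num.max/0]_(i in e) \big[Num.max/0]_(j in e)
        `|xcoord z i - xcoord z j|
     + \big[Num.max/0]_(i in e) \big[Num.max/0]_(j in e)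
        `|ycoord z i - ycoord z j|).

(* wi, hi are the width and height of a cell centred at (x, y); the placement
   region is [0, W] x [0, H]. *)
Definition boundary_penalty (R : realType) (W H wi hi x y : R) : R :=
  ReLU (wi / 2 - x) + ReLU (x - (W - wi / 2))
  + ReLU (hi / 2 - y) + ReLU (y - (H - hi / 2)).

Definition overlap_fun (R : realType) (r t x y : R) : R :=
  if (r <= `|x|) || (t <= `|y|) then 0
  else if `|y| / t <= `|x| / r then 1 - `|x| / r
  else 1 - `|y| / t.

Definition overlap_penalty (R : realType) (wi hi wj hj xi yi xj yj : R) : R :=
  overlap_fun ((wi + wj) / 2) ((hi + hj) / 2) (xi - xj) (yi - yj).

Definition placement_objective (R : realType) (n : nat) (w h : 'I_n -> R)
    (W H : R) (E : {set {set 'I_n}}) (gammab : 'I_n -> R)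
    (gammaxy : 'I_n -> 'I_n -> R) (z : 'rV[R]_(n + n)) : R^o :=
  HPWL E z
  + \sum_(i < n) gammab i *
      boundary_penalty W H (w i) (h i) (xcoord z i) (ycoord z i)
  + \sum_(i < n) \sum_(j < n | (i < j)%N) gammaxy i j *
      overlap_penalty (w i) (h i) (w j) (h j)
        (xcoord z i) (ycoord z i) (xcoord z j) (ycoord z j).

(* Main.v *)
(** The objective is built from coordinate functions by sums, scalings and
    maxima, so along any fixed direction its one-sided slopes take finitely many
    values.  Hence the gradients of [f], and with them the limiting gradients,
    all lie in one finite set, and there are only finitely many candidates for
    the Clarke subdifferential of [f] at a point.  Each of them is bounded, and
    each of them that misses 0 is a closed set, hence at positive distance
    from 0. *)
Require Import Defs.
From HB Require Import structures.
From mathcomp Require Import all_boot all_order all_algebra.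
From mathcomp Require Import all_classical all_reals all_analysis.
From mathcomp Require Import ring lra.

Set Implicit Arguments.
Unset Strict Implicit.
Unset Printing Implicit Defensive.

Import Order.TTheory GRing.Theory Num.Theory.
Import numFieldNormedType.Exports.

Local Open Scope classical_set_scope.
Local Open Scope ring_scope.

(** The list [L] is fixed before [z]: the same finitely many slopes serve all points, while the
    range of [t] may shrink with [z]. The equality is exact, so sums and maxima reduce to algebra at
    small [t], without limits. *)
Definition finite_slopes (R : realType) (V : lmodType R) (v : V) (F : V -> R) :=
  exists L : seq R, forall z, exists2 c, c \in L &
    \forall t \near 0^'+, F (z + t *: v) = F z + t * c.

(** * One-sided slopes, from coordinate functions to the objective *)

Section FiniteSlopes.
Context (R : realType) (V : lmodType R) (v : V).
Implicit Types F G : V -> R.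

Lemma eq_finite_slopes F G : F =1 G -> finite_slopes v F -> finite_slopes v G.
Proof. by move=> /funext ->. Qed.

Lemma finite_slopes_affine F c :
  (forall z t, F (z + t *: v) = F z + t * c) -> finite_slopes v F.
Proof.
move=> Fc; exists [:: c] => z; exists c; first exact: mem_head.
exact: nearW.
Qed.

Lemma finite_slopes_cst a : finite_slopes v (fun=> a).
Proof. by apply: (@finite_slopes_affine _ 0) => z t; rewrite mulr0 addr0. Qed.

Lemma finite_slopesD F G : finite_slopes v F -> finite_slopes v G ->
  finite_slopes v (fun z => F z + G z).
Proof.
move=> [L FL] [M GM]; exists [seq a + b | a <- L, b <- M] => z.
have [a aL Fa] := FL z; have [b bM Gb] := GM z.
exists (a + b); first exact: allpairs_f.
by near=> t; rewrite (near Fa t)// (near Gb t)//; ring.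
Unshelve. all: by end_near. Qed.

Lemma finite_slopesZ k F : finite_slopes v F ->
  finite_slopes v (fun z => k * F z).
Proof.
move=> [L FL]; exists [seq k * a | a <- L] => z; have [a aL Fa] := FL z.
exists (k * a); first exact: map_f.
by near=> t; rewrite (near Fa t)//; ring.
Unshelve. all: by end_near. Qed.

Lemma finite_slopesN F : finite_slopes v F -> finite_slopes v (fun z => - F z).
Proof.
by move=> /(@finite_slopesZ (-1)); apply: eq_finite_slopes => z; rewrite mulN1r.
Qed.

Lemma finite_slopesB F G : finite_slopes v F -> finite_slopes v G ->
  finite_slopes v (fun z => F z - G z).
Proof. by move=> hF /finite_slopesN; exact: finite_slopesD. Qed.

Lemma near_right_lt_affine (a b c d : R) : a < b ->
  \forall t \near 0^'+, a + t * c < b + t * d.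
Proof.
move=> ab; near=> t.
have t0 : 0 < t by near: t; exact: nbhs_right_gt.
(* The added 1 keeps the denominator of the threshold positive when [c = d]. *)
have k0 : 0 < `|c - d| + 1 by rewrite ltr_wpDl.
have : t < (b - a) / (`|c - d| + 1).
  by near: t; apply: nbhs_right_lt; rewrite divr_gt0 // subr_gt0.
rewrite ltr_pdivlMr // => H.
have : t * (c - d) <= t * `|c - d| by rewrite ler_pM2l // ler_norm.
lra.
Unshelve. all: by end_near. Qed.

(** Where the values differ, the larger function stays larger for small [t] and passes on its slope.
    At a tie the slope is the larger of the two. Both cases stay inside [L ++ M]. *)
Lemma finite_slopes_max F G : finite_slopes v F -> finite_slopes v G ->
  finite_slopes v (fun z => Num.max (F z) (G z)).
Proof.
move=> [L FL] [M GM]; exists (L ++ M) => z.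
have [a aL Fa] := FL z; have [b bM Gb] := GM z.
have [FG|GF|FG] := ltgtP (F z) (G z).
- exists b; first by rewrite mem_cat bM orbT.
  have lt_t := near_right_lt_affine a b FG.
  near=> t; rewrite (near Fa t)// (near Gb t)//.
  by apply/max_idPr/ltW; near: t.
- exists a; first by rewrite mem_cat aL.
  have lt_t := near_right_lt_affine b a GF.
  near=> t; rewrite (near Fa t)// (near Gb t)//.
  by apply/max_idPl/ltW; near: t.
- exists (Num.max a b).
    by rewrite mem_cat; case: (leP a b) => _; rewrite ?aL ?bM ?orbT.
  near=> t; rewrite (near Fa t)// (near Gb t)// FG maxr_pMr ?addr_maxr //.
Unshelve. all: by end_near. Qed.

Lemma finite_slopes_norm F : finite_slopes v F ->
  finite_slopes v (fun z => `|F z|).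
Proof.
move=> hF; apply: eq_finite_slopes (fun z => maxrN (F z)) _.
by apply: finite_slopes_max => //; exact: finite_slopesN.
Qed.

Lemma finite_slopes_sum (I : Type) (r : seq I) (P : pred I) (F : I -> V -> R) :
  (forall i, P i -> finite_slopes v (F i)) ->
  finite_slopes v (fun z => \sum_(i <- r | P i) F i z).
Proof.
move=> hF; elim: r => [|i r IHr].
  by apply: eq_finite_slopes (finite_slopes_cst 0) => z; rewrite big_nil.
case: (boolP (P i)) => [/[dup] Pi /hF /finite_slopesD/(_ IHr)|/negPf Pi].
  by apply: eq_finite_slopes => z; rewrite big_cons Pi.
by apply: eq_finite_slopes IHr => z; rewrite big_cons Pi.
Qed.

Lemma finite_slopes_bigmax (I : Type) (r : seq I) (P : pred I)
    (F : I -> V -> R) :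
  (forall i, P i -> finite_slopes v (F i)) ->
  finite_slopes v (fun z => \big[Num.max/0]_(i <- r | P i) F i z).
Proof.
move=> hF; elim: r => [|i r IHr].
  by apply: eq_finite_slopes (finite_slopes_cst 0) => z; rewrite big_nil.
case: (boolP (P i)) => [/[dup] Pi /hF /finite_slopes_max/(_ IHr)|/negPf Pi].
  by apply: eq_finite_slopes => z; rewrite big_cons Pi.
by apply: eq_finite_slopes IHr => z; rewrite big_cons Pi.
Qed.

Lemma finite_slopes_ReLU F : finite_slopes v F ->
  finite_slopes v (fun z => ReLU (F z)).
Proof. by apply: finite_slopes_max; exact: finite_slopes_cst. Qed.

End FiniteSlopes.

(** The overlap penalty is a truncated pyramid over a scaled sup norm, which brings it within reach
    of the closure rules for slopes. The inverses stand on the left to match [finite_slopesZ]. *)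
Lemma overlap_funE (R : realType) (r t x y : R) : 0 < r -> 0 < t ->
  overlap_fun r t x y = ReLU (1 - Num.max (r^-1 * `|x|) (t^-1 * `|y|)).
Proof.
move=> r0 t0; rewrite /overlap_fun /ReLU !(mulrC _^-1).
have -> : (r <= `|x|) = (1 <= `|x| / r) by rewrite ler_pdivlMr // mul1r.
have -> : (t <= `|y|) = (1 <= `|y| / t) by rewrite ler_pdivlMr // mul1r.
rewrite -le_max; set p := `|x| / r; set q := `|y| / t.
have [ge1|lt1] := leP 1 (Num.max p q); first by rewrite max_l // subr_le0.
rewrite max_r; first by rewrite maxC; case: (leP q p).
by rewrite subr_ge0 ltW.
Qed.

Lemma finite_slopes_placement_objective (R : realType) (n : nat)
    (w h : 'I_n -> R) (W H : R) (E : {set {set 'I_n}}) (gammab : 'I_n -> R)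
    (gammaxy : 'I_n -> 'I_n -> R) (v : 'rV[R]_(n + n)) :
  (forall i, 0 < w i) -> (forall i, 0 < h i) ->
  finite_slopes v (placement_objective w h W H E gammab gammaxy).
Proof.
move=> w0 h0.
have fx i : finite_slopes v (@xcoord R n ^~ i).
  by apply: (@finite_slopes_affine _ _ _ _ (xcoord v i)) => z t;
    rewrite /xcoord !mxE.
have fy i : finite_slopes v (@ycoord R n ^~ i).
  by apply: (@finite_slopes_affine _ _ _ _ (ycoord v i)) => z t;
    rewrite /ycoord !mxE.
have fc := @finite_slopes_cst R _ v.
apply: finite_slopesD; first apply: finite_slopesD.
- apply: finite_slopes_sum => e _; apply: finite_slopesD;
    apply: finite_slopes_bigmax => i _; apply: finite_slopes_bigmax => j _;
    exact/finite_slopes_norm/finite_slopesB.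
- apply: finite_slopes_sum => i _; apply: finite_slopesZ.
  by do 3?apply: finite_slopesD; apply: finite_slopes_ReLU;
    apply: finite_slopesB.
- apply: finite_slopes_sum => i _; apply: finite_slopes_sum => j _.
  apply: finite_slopesZ; rewrite /overlap_penalty.
  under eq_fun do rewrite overlap_funE ?divr_gt0 ?addr_gt0 //.
  apply/finite_slopes_ReLU/finite_slopesB => //.
  by apply: finite_slopes_max; apply: finite_slopesZ;
    exact/finite_slopes_norm/finite_slopesB.
Qed.

(** * From one-sided slopes to limiting gradients *)

Lemma derive_right_slope (R : realType) (V : normedModType R) (F : V -> R^o)
    (z v : V) (c : R) : derivable F z v ->
  (\forall t \near 0^'+, F (z + t *: v) = F z + t * c) -> 'D_v F z = c.
Proof.
(* Derivability makes the two-sided limit equal to the right one, and on the right the difference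
   quotient is eventually the constant [c]. *)
move=> dF Fc; rewrite /derive cvg_at_rightE //.
apply: cvg_lim => //; apply: cvg_near_cst; near=> t.
have t0 : 0 < t by near: t; exact: nbhs_right_gt.
rewrite /= [t *: v + z]addrC (near Fc t) // [F z + _]addrC addrK.
by rewrite /GRing.scale /= mulKf ?gt_eqF.
Unshelve. all: by end_near. Qed.

Lemma finite_gradients (R : realType) (N : nat) (F : 'rV[R]_N -> R^o) :
  (forall v, finite_slopes v F) ->
  exists2 D : set 'rV[R]_N, finite_set D &
    forall z, differentiable F z -> D (gradient F z).
Proof.
move=> slF; have /choice[L FL] := fun i : 'I_N => slF (delta_mx 0 i).
(* Pooling the slope lists of all basis directions makes every gradient a row with entries in [s],
   that is, a function into the finite type [seq_sub s]. *)
pose s := flatten [seq L i | i <- enum 'I_N].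
exists [set \row_i val (k i) | k in [set: {ffun 'I_N -> seq_sub s}]].
  apply: finite_image; exact: finite_finset.
move=> z dF.
have Ls i : 'D_(delta_mx 0 i) F z \in s.
  have [c cL Fc] := FL i z.
  rewrite (derive_right_slope (diff_derivable dF) Fc).
  by apply/flatten_mapP; exists i; rewrite ?mem_enum.
exists [ffun i => SeqSub (Ls i)] => //.
by apply/rowP => i; rewrite !mxE ffunE.
Qed.

(** A finite set is closed, so it keeps the limits of gradients drawn from it. *)
Lemma limiting_gradients_sub (R : realType) (N : nat) (F : 'rV[R]_N -> R^o)
    (D : set 'rV[R]_N) :
  finite_set D -> (forall z, differentiable F z -> D (gradient F z)) ->
  forall z, limiting_gradients F z `<=` D.
Proof.
move=> finD DF z g [u [_ du ug]].
apply: (@closed_cvg _ _ _ _ (fun j => gradient F (u j)) D) ug => //.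
  apply: (accessible_finite_set_closed.1 _ _ finD).
  exact/hausdorff_accessible/norm_hausdorff.
by apply: nearW => j; exact: DF.
Qed.

(** * Norm estimates and closed convex hulls *)

Lemma coord_le_norm (R : realType) (N : nat) (s : 'rV[R]_N) (i : 'I_N) :
  `|s 0 i| <= `|s|.
Proof.
rewrite [leRHS]/Num.norm /= mx_normrE; apply/bigmax_geP; right.
by exists (0, i).
Qed.

Lemma norm_le_l2norm (R : realType) (N : nat) (s : 'rV[R]_N) :
  `|s| <= l2norm s.
Proof.
rewrite [leLHS]/Num.norm /= mx_normrE; apply: bigmax_le => [|[j i] _].
  exact: sqrtr_ge0.
rewrite /= ord1 -sqrtr_sqr ler_wsqrtr // (bigD1 i) //= lerDl.
by apply: sumr_ge0 => k _; exact: sqr_ge0.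
Qed.

Lemma l2norm_le_norm (R : realType) (N : nat) (s : 'rV[R]_N) :
  l2norm s <= Num.sqrt (N%:R * `|s| ^+ 2).
Proof.
apply: ler_wsqrtr; rewrite mulr_natl -[X in _ *+ X]card_ord -sumr_const.
apply: ler_sum => i _; rewrite -real_normK ?num_real //.
by rewrite lerXn2r ?nnegrE // coord_le_norm.
Qed.

Lemma closed_closed_convex_hull (R : realType) (N : nat) (A : set 'rV[R]_N) :
  closed (closed_convex_hull A).
Proof. by apply: closed_bigI => C [[]]. Qed.

(** The ball of radius [M] is itself a closed convex set containing [A]. *)
Lemma closed_convex_hull_norm_le (R : realType) (N : nat) (A : set 'rV[R]_N)
    (M : R) : (forall a, A a -> `|a| <= M) ->
  forall s, closed_convex_hull A s -> `|s| <= M.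
Proof.
move=> AM; apply: (@smallest_sub _ _ _ [set s | `|s| <= M]) => //; split.
  apply: (@closed_comp _ _ (fun s : 'rV[R]_N => `|s|) [set x | x <= M]).
    by move=> s _; exact: norm_continuous.
  exact: closed_le.
move=> x y l; rewrite !inE /= => xM yM.
have l0 : 0 <= l%:num by [].
have l1 : 0 <= 1 - l%:num by rewrite subr_ge0.
apply: (le_trans (ler_normD _ _)); rewrite !normrZ (ger0_norm l0) (ger0_norm l1).
have := ler_wpM2l l0 xM; have := ler_wpM2l l1 yM; lra.
Qed.

Lemma closed_convex_hull_dist0 (R : realType) (N : nat) (A : set 'rV[R]_N) :
  ~ closed_convex_hull A 0 ->
  exists2 b : R, 0 < b & forall s, closed_convex_hull A s -> b <= `|s|.
Proof.
move=> A0.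
have : nbhs (0 : 'rV[R]_N) (~` closed_convex_hull A).
  apply: open_nbhs_nbhs; split => //.
  by apply: closed_openC; apply: closed_closed_convex_hull.
move=> /nbhs_norm0P[b /= b0 bA]; exists b => // s As.
by rewrite leNgt; apply/negP => /bA.
Qed.

(** One [b] has to serve all subsets [A] at once; this is possible because a finite set has finitely
    many subsets, so the least of their distance bounds is still positive. *)
Lemma subset_dist0 (R : realType) (N : nat) (D : set 'rV[R]_N) :
  finite_set D ->
  exists2 b : R, 0 < b & forall A, A `<=` D -> ~ closed_convex_hull A 0 ->
    forall s, closed_convex_hull A s -> b <= `|s|.
Proof.
move=> /finite_seqP[r ->].
pose A_ (K : {set seq_sub r}) : set 'rV[R]_N := [set val k | k in [set` K]].
have /choice[b bP] K : exists b : R, 0 < b /\ (~ closed_convex_hull (A_ K) 0 ->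
    forall s, closed_convex_hull (A_ K) s -> b <= `|s|).
  (* When the hull contains 0 nothing is asked of [b], and 1 is a placeholder. *)
  have [K0|/closed_convex_hull_dist0[b b0 bK]] :=
    pselect (closed_convex_hull (A_ K) 0); first by exists 1.
  by exists b.
exists (\big[Num.min/1]_K b K).
  by apply: lt_bigmin => // K _; exact: (bP K).1.
move=> A Ar A0 s As.
(* An arbitrary [A] inside the finite set is one of the indexed subsets, its membership being
   decided classically. *)
have AE : A = A_ [set k | `[< A (val k) >]]%SET.
  apply/seteqP; split => [a Aa|_ [k /= + <-]]; last by rewrite inE => /asboolP.
  by exists (SeqSub (Ar _ Aa)); rewrite //= inE; exact/asboolP.
rewrite AE in A0 As.
apply: le_trans ((bP _).2 A0 _ As); exact: bigmin_le_cond.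
Qed.

Theorem theorem2 (R : realType) (n : nat) (w h : 'I_n -> R) (W H : R)
    (E : {set {set 'I_n}}) (gammab : 'I_n -> R) (gammaxy : 'I_n -> 'I_n -> R)
    (w_gt0 : forall i, 0 < w i) (h_gt0 : forall i, 0 < h i)
    (W_gt0 : 0 < W) (H_gt0 : 0 < H)
    (E_nonempty : forall e, e \in E -> e != finset.set0)
    (gammab_gt0 : forall i, 0 < gammab i)
    (gammaxy_gt0 : forall i j : 'I_n, (i < j)%N -> 0 < gammaxy i j) :
  let f := placement_objective w h W H E gammab gammaxy in
  let S := stationary_points f in
  let G := [set l2norm s | s in \bigcup_(z in ~` S) clarke_subdifferential f z] in
  exists beta Lg : R, [/\ 0 < beta, beta <= Lg, lbound G beta & ubound G Lg].
Proof.
move=> f S G.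
have [D finD fD] := finite_gradients (fun v =>
  finite_slopes_placement_objective W H E gammab gammaxy v w_gt0 h_gt0).
have lgD := limiting_gradients_sub finD fD.
have [b b0 bD] := subset_dist0 finD.
have [M MD] : exists M, forall a, D a -> `|a| <= M.
  have /finite_seqP[r ->] := finD.
  exists (\big[Num.max/0]_(a <- r) `|a|) => a ar.
  exact: le_bigmax_seq.
(* [M] bounds the sup norm on every hull; the factor [n + n], the dimension, converts this to the
   Euclidean norm. *)
pose L := Num.sqrt ((n + n)%:R * M ^+ 2).
(* The maximum secures [beta <= Lg] even when [G] is empty, where no subgradient links [b] to
   [L]. *)
exists b, (Num.max b L); split => //; first by rewrite le_max lexx.
- move=> _ [s [z Sz zs] <-]; apply: le_trans (norm_le_l2norm s).
  exact: bD (lgD z) Sz _ zs.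
- move=> _ [s [z _ zs] <-]; rewrite le_max; apply/orP; right.
  have sM : `|s| <= M by apply: closed_convex_hull_norm_le zs => a /lgD/MD.
  apply: le_trans (l2norm_le_norm s) _; apply: ler_wsqrtr.
  by rewrite ler_wpM2l // lerXn2r ?nnegrE // (le_trans _ sM).
Qed.
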